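(* Let $F\subseteq 2^\omega$ be a set that is both meager and null, and let $T\subseteq 2^{<\omega}$ be a perfect (respectively uniformly perfect, respectively Silver) tree. Then there is a perfect (respectively uniformly perfect, respectively Silver) tree $T'\subseteq T$ such that for every $n\in\omega$ the set $$F+\underbrace{[T']+[T']+\dots+[T']}_{n\text{ times}}$$ is both meager and null.
   Context: Null means of measure zero with respect to the standard product (Haar) probability measure on $2^\omega$. A tree is a nonempty set $T\subseteq 2^{<\omega}$ closed under initial segments. Write $\mathrm{split}(T)=\{\sigma\in T:\sigma^\frown 0\in T\text{ and }\sigma^\frown 1\in T\}$ and $[T]=\{x\in 2^\omega:(\forall n\in\omega)\ x\upharpoonright n\in T\}$. $T$ is perfect if for every $\sigma\in T$ there is $\tau\in\mathrm{split}(T)$ with $\sigma\subseteq\tau$. $T$ is uniformly perfect if it is perfect and for every $n\in\omega$ either $2^n\cap T\subseteq\mathrm{split}(T)$ or $2^n\cap\mathrm{split}(T)=\emptyset$. $T$ is a Silver tree if it is perfect and for all $\sigma,\tau\in T$ with $|\sigma|=|\tau|$ and all $i\in\{0,1\}$: $\sigma^\frown i\in T\iff\tau^\frown i\in T$. On $2^\omega$, $+$ is coordinatewise addition modulo $2$, and $A+B=\{a+b:a\in A,\ b\in B\}$ for $A,B\subseteq 2^\omega$; for $n=0$ the displayed set is read as $F$ itself. *)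

(* Defs.v *)
From HB Require Import structures.
From mathcomp Require Import all_boot all_order all_algebra.
From mathcomp Require Import finmap mathcomp_extra boolp classical_sets functions.
From mathcomp Require Import cardinality fsbigop reals ereal interval_inference.
From mathcomp Require Import topology normedtype sequences esum.
From mathcomp Require Import measure numfun cantor.

Set Implicit Arguments.
Unset Strict Implicit.
Unset Printing Implicit Defensive.

Import Order.TTheory GRing.Theory Num.Theory.
Import numFieldNormedType.Exports.
Local Open Scope classical_set_scope.
Local Open Scope ring_scope.

(** * Trees *)

(* Nodes are words [s : seq bool], extended on the right by [rcons]. *)
Definition tree (T : set (seq bool)) : Prop :=
  T !=set0 /\ forall s t, T t -> prefix s t -> T s.

Definition splitting_nodes (T : set (seq bool)) : set (seq bool) :=
  [set s | [/\ T s, T (rcons s false) & T (rcons s true)]].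

Definition level (n : nat) : set (seq bool) := [set s | size s = n].

Definition body (T : set (seq bool)) : set cantor_space :=
  [set x | forall n, T (mkseq x n)].

Definition perfect_tree (T : set (seq bool)) : Prop :=
  tree T /\ forall s, T s -> exists2 t, splitting_nodes T t & prefix s t.

Definition uniformly_perfect_tree (T : set (seq bool)) : Prop :=
  perfect_tree T /\
  forall n, level n `&` T `<=` splitting_nodes T \/
            level n `&` splitting_nodes T = set0.

Definition silver_tree (T : set (seq bool)) : Prop :=
  perfect_tree T /\
  forall s t, T s -> T t -> size s = size t ->
    forall i, T (rcons s i) <-> T (rcons t i).

(** * Sums in the Cantor group *)

Definition cantor_add (x y : cantor_space) : cantor_space :=
  fun n => x n (+) y n.

Definition sumset (A B : set cantor_space) : set cantor_space :=
  [set cantor_add a b | a in A & b in B].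

Definition add_copies (F B : set cantor_space) (n : nat) : set cantor_space :=
  iter n (fun A => sumset A B) F.

(** * Category *)

Definition nowhere_dense (X : topologicalType) (A : set X) : Prop :=
  interior (closure A) = set0.

Definition meager (X : topologicalType) (A : set X) : Prop :=
  exists2 N : (set X)^nat, (forall n, nowhere_dense (N n)) & A = \bigcup_n N n.

(** * The product measure *)

(* The fair-coin measure is the Caratheodory extension of its values on the
   algebra of the sets determined by finitely many coordinates. *)

Definition determined (N : nat) (A : set cantor_space) : Prop :=
  forall x y : cantor_space,
    (forall i, (i < N)%N -> x i = y i) -> A x -> A y.

Definition finitely_determined : set (set cantor_space) :=
  [set A | exists N, determined N A].

Definition cantor_cons (b : bool) (x : cantor_space) : cantor_space :=
  fun n => if n is m.+1 then x m else b.

Lemma determined_leq N M A : (N <= M)%N -> determined N A -> determined M A.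
Proof.
by move=> NM dA x y xy; apply: dA => i iN; apply: xy; exact: leq_trans NM.
Qed.

Lemma determinedC N A : determined N A -> determined N (~` A).
Proof. by move=> dA x y xy nAx Ay; apply: nAx; apply: dA Ay => i /xy. Qed.

Lemma determinedU N A B :
  determined N A -> determined N B -> determined N (A `|` B).
Proof.
by move=> dA dB x y xy [Ax|Bx]; [left; exact: dA Ax|right; exact: dB Bx].
Qed.

Lemma determined_cons N A b :
  determined N.+1 A -> determined N (cantor_cons b @^-1` A).
Proof. by move=> dA x y xy; apply: dA => -[//|i] iN /=; exact: xy. Qed.

Definition coin_algebraType : Type := cantor_space.

HB.instance Definition _ := Pointed.on coin_algebraType.

Fact coin_algebra_display : measure_display.
Proof. exact: default_measure_display. Qed.

Lemma finitely_determined0 : finitely_determined set0.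
Proof. by exists 0%N. Qed.

Lemma finitely_determinedU : setU_closed finitely_determined.
Proof.
move=> A B [N dA] [M dB]; exists (maxn N M); apply: determinedU.
  exact: determined_leq (leq_maxl _ _) dA.
exact: determined_leq (leq_maxr _ _) dB.
Qed.

Lemma finitely_determinedC : setC_closed finitely_determined.
Proof. by move=> A [N dA]; exists N; exact: determinedC. Qed.

HB.instance Definition _ :=
  @isAlgebraOfSets.Build coin_algebra_display coin_algebraType
    finitely_determined finitely_determined0 finitely_determinedU
    finitely_determinedC.

Section coin_measure.
Context {R : realType}.

(* The proportion of the words of length [N] whose extension by zeros lies
   in [A]. *)
Fixpoint coin_weight (N : nat) (A : set cantor_space) : R :=
  if N is n.+1 then
    (coin_weight n (cantor_cons false @^-1` A) +
     coin_weight n (cantor_cons true @^-1` A)) / 2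
  else \1_A ((fun=> false) : cantor_space).

Lemma coin_weightSE N A : coin_weight N.+1 A =
  (coin_weight N (cantor_cons false @^-1` A) +
   coin_weight N (cantor_cons true @^-1` A)) / 2.
Proof. by []. Qed.

Lemma coin_weight_ge0 N A : 0 <= coin_weight N A.
Proof.
elim: N A => [|N IH] A /=; first by rewrite indicE.
by rewrite divr_ge0// addr_ge0.
Qed.

Lemma coin_weight0 N : coin_weight N set0 = 0.
Proof.
elim: N => [|N IH] /=; first by rewrite indic0.
by rewrite !preimage_set0 IH addr0 mul0r.
Qed.

Lemma coin_weightT N : coin_weight N setT = 1.
Proof.
elim: N => [|N IH] /=; first by rewrite indicT.
by rewrite !preimage_setT IH divff.
Qed.

Lemma coin_weightU N A B : A `&` B = set0 ->
  coin_weight N (A `|` B) = coin_weight N A + coin_weight N B.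
Proof.
elim: N A B => [|N IH] A B AB /=.
  have nAB x : A x -> ~ B x by move=> Ax Bx; rewrite -[False]/(set0 x) -AB.
  rewrite !indicE in_setU; have [/set_mem Ax|_] := boolP (_ \in A); last first.
    by rewrite add0r.
  by rewrite memNset ?addr0//; exact: nAB.
have ABc b : (cantor_cons b @^-1` A) `&` (cantor_cons b @^-1` B) = set0.
  by rewrite -preimage_setI AB preimage_set0.
rewrite !preimage_setU (IH _ _ (ABc false)) (IH _ _ (ABc true)).
by rewrite addrACA mulrDl.
Qed.

Lemma coin_weightS N A : determined N A -> coin_weight N.+1 A = coin_weight N A.
Proof.
elim: N A => [|N IH] A dA.
  have E x y : A x -> A y by apply: dA.
  have [[a Aa]|/forallNP An] := pselect (exists a, A a).
    have -> : A = setT by apply/seteqP; split => // x _; exact: E Aa.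
    by rewrite !coin_weightT.
  have -> : A = set0 by apply/seteqP; split => // x /An.
  by rewrite !coin_weight0.
rewrite coin_weightSE [RHS]coin_weightSE.
by rewrite !IH//; exact: determined_cons.
Qed.

Lemma coin_weight_eq N M A :
  determined N A -> determined M A -> coin_weight N A = coin_weight M A.
Proof.
move=> dN dM; wlog NM : N M dN dM / (N <= M)%N.
  by move=> h; case: (leqP N M) => [|/ltnW] ?; [|apply/esym]; exact: h.
move: NM => /subnK <-; elim: (M - N)%N => // k ->.
by rewrite addSn coin_weightS//; apply: determined_leq dN; exact: leq_addl.
Qed.

(* [coin_weight N A] does not depend on the choice of [N] once
   [determined N A] holds: see [coin_weight_eq]. *)
Definition coin_content (A : set coin_algebraType) : \bar R :=
  (coin_weight (xget 0%N [set N | determined N A]) A)%:E.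

Lemma coin_contentE N A : determined N A -> coin_content A = (coin_weight N A)%:E.
Proof.
move=> dA; congr EFin; apply: coin_weight_eq => //.
exact: (@xgetPex _ 0%N [set N | determined N A] (ex_intro _ N dA)).
Qed.

Let coin_content_ge0 A : (0 <= coin_content A)%E.
Proof. by rewrite lee_fin coin_weight_ge0. Qed.

Let coin_content_additive : measure_function.semi_additive coin_content.
Proof.
apply/additive2P; first by rewrite (@coin_contentE 0%N) ?coin_weight0.
move=> A B [N dA] [M dB] AB.
have {}dA := determined_leq (leq_maxl N M) dA.
have {}dB := determined_leq (leq_maxr N M) dB.
rewrite (coin_contentE dA) (coin_contentE dB) (coin_contentE (determinedU dA dB)).
by rewrite coin_weightU.
Qed.

HB.instance Definition _ := isContent.Build _ coin_algebraType R coin_content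
  coin_content_ge0 coin_content_additive.

Lemma near_agree (x : cantor_space) N :
  \forall y \near x, forall i, (i < N)%N -> x i = y i.
Proof.
elim: N => [|N IH]; first by apply: filterE => y i; rewrite ltn0.
have : \forall y \near x, x N = y N.
  have /(_ [set x N] (discrete_set1 _)) := @proj_continuous nat (fun=> bool) N x.
  by apply: filterS => y /= ->.
move: IH; apply: filterS2 => y xy xyN i.
by rewrite ltnS leq_eqVlt => /predU1P[->//|]; exact: xy.
Qed.

Lemma finitely_determined_open A : finitely_determined A -> open A.
Proof.
move=> [N dA]; rewrite openE => x Ax; rewrite /interior.
by have := near_agree x N; apply: filterS => y xy; exact: dA xy Ax.
Qed.

Lemma finitely_determined_compact A : finitely_determined A -> compact A.
Proof.
move=> mA; apply: (subclosed_compact _ cantor_space_compact) => //.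
rewrite -(setCK A); apply: open_closedC; apply: finitely_determined_open.
exact: finitely_determinedC.
Qed.

Let coin_content_sigma_subadditive :
  measurable_subset_sigma_subadditive coin_content.
Proof.
move=> A F mF mA AF; rewrite /subset_sigma_subadditive.
have := finitely_determined_compact mA; rewrite compact_cover.
move=> /(_ _ [set: nat] F (fun i _ => finitely_determined_open (mF i)) AF).
move=> [X _ AX].
have AX' : A `<=` \bigcup_(i in [set` X]) F i by exact: AX.
apply: (le_trans (content_sub_fsum coin_content (finite_fset X)
  (fun i _ => mF i) mA AX')).
rewrite nneseries_esum; last by move=> *; exact: measure_ge0.
rewrite esum_ge//; exists [set` X] => //.
Qed.

HB.instance Definition _ := Content_SigmaSubAdditive_isMeasure.Build _ R
  coin_algebraType coin_content coin_content_sigma_subadditive.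

Definition coin_measure := measure_extension coin_content.
HB.instance Definition _ := Measure.on coin_measure.

Lemma coin_measureE N A :
  determined N A -> coin_measure A = (coin_weight N A)%:E.
Proof.
move=> dA; rewrite -(coin_contentE dA) /coin_measure /measure_extension.
by rewrite measurable_mu_extE//; exists N.
Qed.

Let coin_measureT : coin_measure setT = 1%E.
Proof. by rewrite (@coin_measureE 0%N)// coin_weightT. Qed.

HB.instance Definition _ :=
  @Measure_isProbability.Build _ _ _ coin_measure coin_measureT.

Lemma coin_measure_cylinder (s : seq bool) :
  coin_measure [set x : cantor_space | mkseq x (size s) = s] =
  ((2 ^+ size s)^-1)%:E.
Proof.
rewrite (@coin_measureE (size s)); last first.
  move=> x y xy /= <-; rewrite size_mkseq; apply/eq_in_map => i.
  by rewrite mem_iota => /xy.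
congr EFin; elim: s => [|b s IH].
  by rewrite /= indicE mem_set//= invr1.
have E c : cantor_cons c @^-1` [set x | mkseq x (size (b :: s)) = b :: s] =
    if c == b then [set x : cantor_space | mkseq x (size s) = s] else set0.
  have mE (x : cantor_space) : mkseq (cantor_cons c x) (size s).+1 =
      c :: mkseq x (size s).
    by rewrite /mkseq /= -[1%N]addn0 iotaDl -map_comp.
  apply/seteqP; split => x /=; rewrite mE.
    by move=> [-> xs]; rewrite eqxx.
  by case: eqP => //= -> ->.
rewrite [LHS]/= !E exprS invfM mulrC -IH.
by case: b {E} => /=; rewrite coin_weight0 ?add0r ?addr0.
Qed.

End coin_measure.

Arguments coin_measure : clear implicits.

(* The finitely determined sets generate the Borel sigma-algebra, so negligible
   means contained in a Borel set of measure zero. *)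
Definition null (R : realType) (A : set cantor_space) : Prop :=
  (coin_measure R).-negligible A.

(* Main.v *)
Require Import Defs.
From mathcomp Require Import all_boot all_order all_algebra.
From mathcomp Require Import mathcomp_extra boolp classical_sets.
From mathcomp Require Import reals ereal topology normedtype sequences esum.
From mathcomp Require Import measure cantor.

Set Implicit Arguments.
Unset Strict Implicit.
Unset Printing Implicit Defensive.

Local Open Scope classical_set_scope.

(** The proof separates the set from the tree. To a set [F] that is meager and
    null it attaches a rate [h : nat -> nat] such that the sum of [F] with any
    set having few restrictions to the first [h k] coordinates, for almost
    every [k], is again meager and null. The given tree is then thinned so much
    that the finite sums of its body have few restrictions in this sense. Few
    means at most [2 ^ (k * k)]: if the body of [T'] has at most [2 ^ k]
    restrictions to the first [h k] coordinates, then its [n]-fold sum has at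
    most [2 ^ (k * n)], which is below [2 ^ (k * k)] as soon as [n <= k]. This
    is the notion [thin], and one rate serves all [n] at once.

    Null part ([null_sumset]). Countably many covers of [F], regrouped into
    finite blocks, put [F] inside the limsup of clopen sets [D k], where [D k]
    depends on the first [h k] coordinates only and its measure is below
    [2 ^- (k * k)] by a summable factor ([null_limsup_fast]). As far as [D k] is
    concerned, a thin [P] consists of at most [2 ^ (k * k)] points, so [D k + P]
    lies in that many translates of [D k]. Their measures remain summable, and
    Borel-Cantelli applies.

    Meager part ([meager_sumset]). If [A] is nowhere dense and a number [b] and
    a length [m] are given, then some length [M] has the property that, for any
    [b] translates of [A], every word of length [m] extends to a word of length
    [M] whose cylinder misses them all: the translates are avoided one after
    the other, and each time a bound common to the finitely many words of the
    current length is taken ([escape_translates]). With [F] the union of the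
    nowhere dense sets [N i], [h k] is such an [M] for [m = k],
    [b = 2 ^ (k * k)] and [A] the union of the [N i] with [i <= k]. Of a thin
    [P], only [2 ^ (k * k)] translates matter below length [h k].

    Thinning. Along every branch of [T] one follows the tree, but after having
    met [c] kept branchings one ignores every further splitting node of length
    less than [h c], always going to [false] there. The next splitting node is
    kept, so the result is perfect; a node of length [h k] has at most [k] kept
    branchings below it, so there are at most [2 ^ k] such nodes
    ([thinning_level]). If in [T] splitting depends only on the length of the
    node, as in uniformly perfect trees and in Silver trees, then so does being
    kept, and therefore the single construction [thinning] preserves all three
    classes of trees. *)

(** * Cylinders and nowhere dense sets *)

Definition agree (N : nat) (x y : cantor_space) : Prop :=
  forall i, i < N -> x i = y i.

Lemma agree_refl N x : agree N x x. Proof. by []. Qed.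

Lemma agree_sym N x y : agree N x y -> agree N y x.
Proof. by move=> xy i /xy. Qed.

Lemma agree_trans N y x z : agree N x y -> agree N y z -> agree N x z.
Proof. by move=> xy yz i iN; rewrite xy// yz. Qed.

Lemma agree_leq N M x y : N <= M -> agree M x y -> agree N x y.
Proof. by move=> NM xy i iN; apply: xy; exact: leq_trans NM. Qed.

Lemma agree_add N x x' y y' : agree N x x' -> agree N y y' ->
  agree N (cantor_add x y) (cantor_add x' y').
Proof. by move=> xx yy i iN; rewrite /cantor_add xx// yy. Qed.

Lemma cantor_addK y : involutive (fun x => cantor_add x y).
Proof. by move=> x; apply/funext => i; rewrite /cantor_add addbK. Qed.

Lemma cantor_addA x y z :
  cantor_add (cantor_add x y) z = cantor_add x (cantor_add y z).
Proof. by apply/funext => i; rewrite /cantor_add addbA. Qed.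

Lemma open_agree N x : open (agree N x).
Proof.
apply: finitely_determined_open; exists N => y z yz xy.
exact: agree_trans yz.
Qed.

(** Cylinders form a neighbourhood base: the filter that they generate converges
    to [x] coordinatewise, hence in the product topology. *)
Lemma nbhs_agree (x : cantor_space) (A : set cantor_space) :
  nbhs x A -> exists N, agree N x `<=` A.
Proof.
pose G : set_system cantor_space := [set A | exists N, agree N x `<=` A].
have GF : Filter G.
  split; first by exists 0.
  - move=> B C [N NB] [M MC]; exists (maxn N M) => y xy; split.
      by apply: NB; exact: agree_leq (leq_maxl _ _) xy.
    by apply: MC; exact: agree_leq (leq_maxr _ _) xy.
  - by move=> B C BC [N NB]; exists N; exact: subset_trans BC.
suff : G --> x by apply.
apply/cvg_sup => i; apply/cvg_image.
  by apply/seteqP; split => // b _; exists (fun=> b).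
move=> B /= /nbhs_singleton Bx; exists (proj i @^-1` B); last first.
  by rewrite image_preimage//; apply/seteqP; split => // b _; exists (fun=> b).
by exists i.+1 => y xy; rewrite /preimage/= /proj -(xy i).
Qed.

(** Nowhere density on the level of words: every word extends to one whose
    cylinder misses [A]. *)
Definition escapable (A : set cantor_space) : Prop :=
  forall m x, exists M y, agree m x y /\ agree M y `&` A = set0.

Lemma nowhere_denseP (A : set cantor_space) : nowhere_dense A <-> escapable A.
Proof.
split=> [ndA m x|eA].
  have : ~ (agree m x `<=` closure A).
    move=> sub; rewrite -[False]/(set0 x) -ndA.
    apply: (filterS sub); apply: open_nbhs_nbhs.
    by split; [exact: open_agree|exact: agree_refl].
  move=> /existsNP[y /not_implyP[xy]] /existsNP[B /not_implyP[yB]].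
  move=> /set0P/negP/negPn/eqP AB.
  have [M MB] := nbhs_agree yB; exists M, y; split => //.
  by rewrite -subset0 setIC -AB; exact: setIS.
rewrite /nowhere_dense -subset0 => x /nbhs_agree[m mA].
have [M [y [xy]]] := eA m x; apply/eqP/set0P.
rewrite setIC; apply: (mA _ xy); apply: open_nbhs_nbhs.
by split; [exact: open_agree|exact: agree_refl].
Qed.

Lemma escapableS A B : A `<=` B -> escapable B -> escapable A.
Proof.
move=> AB eB m x; have [M [y [xy yB]]] := eB m x; exists M, y; split => //.
by rewrite -subset0 -yB; exact: setIS.
Qed.

Lemma escapableU A B : escapable A -> escapable B -> escapable (A `|` B).
Proof.
move=> eA eB m x; have [M [y [xy yA]]] := eA m x.
have [M' [z [yz zB]]] := eB (maxn m M) y.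
exists (maxn M M'), z; split.
  by apply: agree_trans xy _; exact: agree_leq (leq_maxl _ _) yz.
rewrite -subset0 => t [zt [At|Bt]].
  rewrite -yA; split => //; apply: (@agree_trans _ z).
    exact: agree_leq (leq_maxr _ _) yz.
  exact: agree_leq (leq_maxl _ _) zt.
by rewrite -zB; split => //; exact: agree_leq (leq_maxr _ _) zt.
Qed.

Lemma escapable_bigcup (N : nat -> set cantor_space) n :
  (forall i, escapable (N i)) ->
  escapable (\bigcup_(i in [set i | i <= n]) N i).
Proof.
move=> eN; elim: n => [|n IH].
  by apply: escapableS (eN 0) => x [i /=]; rewrite leqn0 => /eqP ->.
apply: escapableS (escapableU IH (eN n.+1)) => x [i /=].
rewrite leq_eqVlt => /predU1P[->|im Nx]; first by right.
by left; exists i.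
Qed.

(** Only the [2 ^ m] words of length [m] matter, so the maximum of finitely many
    witnesses works for all points. *)
Lemma uniform_bound m (Q : cantor_space -> nat -> Prop) :
  (forall x y M M', agree m x y -> M <= M' -> Q x M -> Q y M') ->
  (forall x, exists M, Q x M) -> exists M, forall x, Q x M.
Proof.
move=> mQ /choice[g gQ].
pose pt (t : m.-tuple bool) : cantor_space := fun i => nth false t i.
exists (\max_t g (pt t)) => x; pose t := [tuple x i | i < m].
apply: (mQ (pt t)) (gQ _); last exact: (leq_bigmax t).
by move=> i im; rewrite /pt (nth_mktuple _ _ (Ordinal im)).
Qed.

(** * Sums of a meager set and a thin set *)

(** The length [M] has to be chosen before the translates: later it becomes a
    value of the rate [h], whereas the translations come from a set that is
    thin for [h]. This is why the bound must be uniform in [x] and [l]. *)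
Lemma escape_translates A b m : escapable A -> exists2 M, m <= M &
  forall x (l : seq cantor_space), size l <= b -> exists y, agree m x y /\
    forall q z, q \in l -> agree M y z -> ~ A (cantor_add z q).
Proof.
move=> eA; elim: b => [|b [M mM IH]].
  by exists m => // x [|//] _; exists x; split.
(* First leave the translates in [l], then the one by [q]; translating by [q]
   turns the latter task into leaving [A] itself. *)
have [M' M'P] : exists M', forall x, exists y,
    agree M x y /\ agree M' y `&` A = set0.
  apply: (@uniform_bound M) => [x x' N N' xx' NN' [y [xy yA]]|x].
    exists y; split; first exact: agree_trans (agree_sym xx') xy.
    by rewrite -subset0 -yA => z [yz Az]; split=> //; exact: agree_leq yz.
  by have [N [y ?]] := eA M x; exists N, y.
exists (maxn M M'); first exact: leq_trans (leq_maxl _ _).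
move=> x [_|q l lb]; first by exists x; split.
have [y1 [xy1 y1l]] := IH x l lb.
have [y2 [y12 y2A]] := M'P (cantor_add y1 q).
have y1y2 : agree M y1 (cantor_add y2 q).
  by rewrite -[y1](cantor_addK q); exact: agree_add.
exists (cantor_add y2 q); split.
  by apply: agree_trans xy1 _; exact: agree_leq y1y2.
move=> q' z; rewrite inE => /predU1P[->|q'l] yz.
  move=> Az; rewrite -[False]/(set0 (cantor_add z q)) -y2A; split=> //.
  rewrite -[y2](cantor_addK q); apply: agree_add => //.
  exact: agree_leq (leq_maxr _ _) yz.
apply: y1l => //; apply: (agree_trans y1y2).
exact: agree_leq (leq_maxl _ _) yz.
Qed.

(** The bound [2 ^ (k * k)] dominates every [2 ^ (k * n)], so that thin sets
    include the finite sums of a set with [2 ^ k] restrictions. *)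
Definition thin (h : nat -> nat) (P : set cantor_space) : Prop :=
  exists d, forall k, d <= k -> exists2 l : seq cantor_space,
    size l <= 2 ^ (k * k) &
    forall x, P x -> exists2 y, y \in l & agree (h k) x y.

Lemma meager_sumset F : meager F ->
  exists h, forall P, thin h P -> meager (sumset F P).
Proof.
move=> [N ndN ->].
pose K k := \bigcup_(i in [set i | i <= k]) N i.
have eK k : escapable (K k).
  by apply: escapable_bigcup => i; exact/nowhere_denseP.
have [h hP] := choice (fun k => (let: ex_intro2 M _ MP :=
  escape_translates (2 ^ (k * k)) k (eK k) in ex_intro _ M MP)).
exists h => P [d dP].
exists (fun n => sumset (K n) P); last first.
  apply/seteqP; split.
    move=> _ [x [n _ Nx] [p Pp <-]].
    by exists n => //; exists x; [exists n => //=|exists p].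
  by move=> _ [n _ [x [i _ Nx] [p Pp <-]]]; exists x; [exists i|exists p].
move=> n; apply/nowhere_denseP => m x.
pose k := maxn d (maxn m n); have [l lk lP] := dP k (leq_maxl _ _).
have [y [xy yl]] := hP k x l lk.
exists (h k), y; split.
  by apply: agree_leq xy; rewrite !leq_max leqnn orbT.
rewrite -subset0 => z [yz [f [i /= iN Nf] [p Pp fp]]].
have [q ql pq] := lP p Pp.
apply: (yl q (cantor_add f q) ql).
  by apply: agree_trans yz _; rewrite -fp; exact: agree_add.
(* [f] is a point of [K k], and [f + q] agrees with [z], hence with [y]. *)
rewrite cantor_addK; exists i => //=.
by rewrite (leq_trans iN)// !leq_max leqnn !orbT.
Qed.

(** * Sums of a null set and a thin set *)

Section Null.
Context (R : realType).
Import Order.TTheory GRing.Theory Num.Theory.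
Local Open Scope ring_scope.
Local Open Scope ereal_scope.
Notation mu := (coin_measure R).

Lemma finitely_determined_measurable (A : set cantor_space) :
  finitely_determined A ->
  measurable (A : set (g_sigma_algebraType (@measurable _ coin_algebraType))).
Proof. exact: sub_sigma_algebra. Qed.

Lemma finitely_determined_bigsetU (I : Type) (r : seq I)
    (A : I -> set cantor_space) :
  (forall i, finitely_determined (A i)) ->
  finitely_determined (\big[setU/set0]_(i <- r) A i).
Proof.
move=> fA; elim/big_ind : _ => //; first exact: finitely_determined0.
exact: finitely_determinedU.
Qed.

Lemma coin_measure_bigsetU (I : Type) (r : seq I)
    (A : I -> set cantor_space) :
  (forall i, finitely_determined (A i)) ->
  mu (\big[setU/set0]_(i <- r) A i) <= \sum_(i <- r) mu (A i).
Proof.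
move=> fA; elim: r => [|i r IH]; first by rewrite !big_nil measure0.
rewrite !big_cons; apply: le_trans (leeD2l _ IH).
apply: measureU2; apply: finitely_determined_measurable; first exact: fA.
exact: finitely_determined_bigsetU.
Qed.

(** Translating by [q] only exchanges the two halves of the space when
    [q 0 = true], and acts within the halves by the shift of [q]. *)
Lemma coin_weight_translate N (D : set cantor_space) (q : cantor_space) :
  determined N D ->
  coin_weight N (cantor_add^~ q @^-1` D) = coin_weight N D :> R.
Proof.
elim: N D q => [|N IH] D q dD.
  by congr coin_weight; apply/seteqP; split => x; apply: dD.
have E b : cantor_cons b @^-1` (cantor_add^~ q @^-1` D) =
    cantor_add^~ (fun n => q n.+1) @^-1` (cantor_cons (b (+) q 0%N) @^-1` D).
  apply/funext => x; rewrite /preimage /=; congr (D _).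
  by apply/funext => -[|n].
rewrite [LHS]coin_weightSE [RHS]coin_weightSE !E !IH; last 2 first.
- exact: determined_cons.
- exact: determined_cons.
by case: (q 0%N) => //=; rewrite addrC.
Qed.

Lemma determined_translate N (D : set cantor_space) q :
  determined N D -> determined N (cantor_add^~ q @^-1` D).
Proof.
by move=> dD x y xy; apply: dD; exact: agree_add.
Qed.

Lemma coin_measure_translate N (D : set cantor_space) q : determined N D ->
  mu (cantor_add^~ q @^-1` D) = mu D.
Proof.
move=> dD; rewrite (coin_measureE dD) (coin_measureE (determined_translate dD)).
by rewrite coin_weight_translate.
Qed.

(** The measure is the outer measure of the content on finitely determined
    sets, so an infimum over countable covers by such sets. *)
Lemma null_cover (A : set cantor_space) (e : R) : null R A -> (0 < e)%R ->
  exists C : nat -> set cantor_space, [/\ forall n, finitely_determined (C n),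
    A `<=` \bigcup_n C n & \sum_(n <oo) mu (C n) <= e%:E].
Proof.
move=> [B [mB B0 AB]] e0.
have : mu_ext (@coin_content R) B = 0 by [].
rewrite /mu_ext; set S := (X in ereal_inf X) => inf0.
have /(lb_ereal_inf_adherent e0) : ereal_inf S \is a fin_num by rewrite inf0.
move=> [_ [C [mC BC] <-]]; rewrite inf0 add0e => /ltW Ce.
exists C; split => //; first exact: subset_trans BC.
rewrite (eq_eseriesr (g := fun n => @coin_content R (C n)))// => n _.
exact: measurable_mu_extE.
Qed.

(** The converse of Borel-Cantelli for null sets. With covers [C k] of total
    measure at most [2 ^- k.+1], the set [E m] collects all [C k n] with
    [maxn k n = m]: each [C k] contributes to an [E m] with [k <= m], so a
    point of [F] lies in infinitely many of them. *)
Lemma null_limsup F : null R F -> exists E : nat -> set cantor_space,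
  [/\ forall n, finitely_determined (E n), F `<=` lim_sup_set E &
      \sum_(n <oo) mu (E n) < +oo].
Proof.
move=> nF.
have [C CP] := choice (fun k : nat =>
  @null_cover F (1 / (2 ^ k.+1)%:R)%R nF (ltac:(by []))).
have fC k n : finitely_determined (C k n) by case: (CP k).
pose E m := \big[setU/set0]_(k <- iota 0 m.+1) C k m `|`
  \big[setU/set0]_(n <- iota 0 m.+1) C m n.
have fE m : finitely_determined (E m).
  by apply: finitely_determinedU; exact: finitely_determined_bigsetU.
exists E; split => //.
  move=> x Fx k _; have [_ /(_ _ Fx)[n _ Cx] _] := CP k.
  exists (maxn k n); first by rewrite /= leq_maxl.
  have [kn|nk] := leqP k n; [left|right]; rewrite -bigcup_seq.
    by exists k => //; rewrite /mkset mem_iota.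
  by exists n => //; rewrite /mkset mem_iota add0n ltnS (ltnW nk).
have part (a : nat -> set cantor_space) m :
    (forall n, finitely_determined (a n)) ->
    mu (\big[setU/set0]_(k <- iota 0 m) a k) <= \sum_(k <oo) mu (a k).
  move=> fa; apply: le_trans (coin_measure_bigsetU _ fa) _.
  rewrite -{1}[m]subn0; exact: nneseries_lim_ge.
apply: (@le_lt_trans _ _ (\sum_(m <oo)
    (\sum_(k <oo) mu (C k m) + \sum_(n <oo) mu (C m n)))).
  apply: lee_nneseries => // m _.
  apply: le_trans (measureU2 _ _ _) (leeD _ _).
  - apply: finitely_determined_measurable.
    exact: finitely_determined_bigsetU.
  - apply: finitely_determined_measurable.
    exact: finitely_determined_bigsetU.
  - by apply: part.
  - exact: part.
have le1 : \sum_(m <oo) \sum_(n <oo) mu (C m n) <= 1%:E.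
  apply: le_trans (epsilon_trick0 xpredT (ler01)).
  apply: lee_nneseries => m _; first by move=> _; exact: nneseries_ge0.
  by case: (CP m).
rewrite nneseriesD; last 2 first.
- by move=> *; exact: nneseries_ge0.
- by move=> *; exact: nneseries_ge0.
rewrite nneseries_interchange//.
by apply: le_lt_trans (leeD le1 le1) _; rewrite ltry.
Qed.

(** Finite unions of consecutive terms of a summable sequence can be made as
    small as desired, by letting the blocks start late. *)
Lemma null_limsup_fast F (e : nat -> R) : (forall k, 0 < e k)%R -> null R F ->
  exists (h : nat -> nat) (D : nat -> set cantor_space),
  [/\ forall k, determined (h k) (D k), F `<=` lim_sup_set D &
      forall k, mu (D k) <= (e k)%:E].
Proof.
move=> e0 /null_limsup[E [fE FE Eoo]].
have /choice[s sP] k : exists M, forall N, (M <= N)%N ->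
    \sum_(N <= i <oo) mu (E i) <= (e k)%:E.
  have /(_ [set x | x < (e k)%:E]) :=
    nneseries_tail_cvg Eoo (fun k _ => measure_ge0 mu (E k)).
  have : nbhs (0 : \bar R) [set x | x < (e k)%:E].
    apply: open_nbhs_nbhs; split; first exact: open_ereal_lt_ereal.
    by rewrite /= lte_fin.
  move=> /[swap]/[apply] -[N _ NP]; exists N => M /NP /ltW; apply.
(* The start of block [k]: beyond [s k], and strictly increasing in [k]. *)
pose t k := (\sum_(i < k.+1) (s i).+1)%N.
have tS k : t k.+1 = (t k + (s k.+1).+1)%N by rewrite /t big_ord_recr.
have st k : (s k <= t k)%N by rewrite /t big_ord_recr /= addnS leqW// leq_addl.
have tk k : (k <= t k)%N.
  by elim: k => // k IH; rewrite tS addnS ltnS (leq_trans IH)// leq_addr.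
pose D k := \big[setU/set0]_(i <- index_iota (t k) (t k.+1)) E i.
have fD k : finitely_determined (D k) by exact: finitely_determined_bigsetU.
have [h hD] := choice fD.
exists h, D; split => // [x Fx m _|k]; last first.
  apply: le_trans (coin_measure_bigsetU _ fE) (le_trans _ (sP k (t k) (st k))).
  exact: nneseries_lim_ge.
(* If no block from the [m]th on contained [x], then no [E j] with [t m <= j]
   would. *)
have [i /= mi Ei] := FE x Fx (t m) I.
apply: contrapT => nD.
suff : forall k j, (m <= k)%N -> (t m <= j < t k)%N -> ~ E j x.
  move=> /(_ i.+1 i); apply => //; first by rewrite (leq_trans (tk m))// ltnW.
  by rewrite mi/= tk.
move=> k j /subnKC <-; elim: (k - m)%N => [|n IH].
  by rewrite addn0; case: leqP => // + /ltnW; rewrite leqNgt => /negP.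
rewrite addnS => /andP[mj jn]; have [|nj] := ltnP j (t (m + n)%N).
  by move=> jn'; apply: IH; rewrite mj.
move=> Ej; apply: nD; exists (m + n)%N; first exact: leq_addr.
by rewrite /D -bigcup_seq; exists j => //=; rewrite mem_index_iota nj.
Qed.

Lemma null_sumset F : null R F ->
  exists h, forall P, thin h P -> null R (sumset F P).
Proof.
(* Room for [2 ^ (k * k)] translates, and summable after they are used up. *)
pose e k : R := (1 / (2 ^ (k * k) * 2 ^ k.+1)%:R)%R.
have e0 k : (0 < e k)%R by rewrite divr_gt0// ltr0n muln_gt0 !expn_gt0.
move=> /(null_limsup_fast e0)[h [D [hD FD De]]].
exists h => P [d dP].
have /choice[l lP] k : exists l : seq cantor_space, (d <= k)%N ->
    (size l <= 2 ^ (k * k))%N /\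
    forall x, P x -> exists2 y, y \in l & agree (h k) x y.
  have [/dP[l lk lP]|] := leqP d k; first by exists l.
  by exists [::].
pose U k := if (d <= k)%N then
  \big[setU/set0]_(q <- l k) (cantor_add^~ q @^-1` D k) else set0.
have fDq k q : finitely_determined (cantor_add^~ q @^-1` D k).
  by exists (h k); exact: determined_translate.
have fU k : finitely_determined (U k).
  rewrite /U; case: ifP => _; last exact: finitely_determined0.
  exact: finitely_determined_bigsetU.
exists (lim_sup_set U); split.
- apply: bigcapT_measurable => n; apply: bigcup_measurable => k _.
  exact: finitely_determined_measurable.
- apply: lim_sup_set_cvg0 => [k|]; first exact: finitely_determined_measurable.
  apply: (@le_lt_trans _ _ 1%:E); last by rewrite ltry.
  apply: le_trans (epsilon_trick0 xpredT (ler01)).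
  apply: lee_nneseries => [//|k _]; rewrite /U; case: ifP => dk; last first.
    by rewrite measure0 lee_fin.
  apply: le_trans (coin_measure_bigsetU _ (fDq k)) _.
  apply: (@le_trans _ _ (\sum_(q <- l k) (e k)%:E)).
    by apply: lee_sum => q _; rewrite (coin_measure_translate _ (hD k)).
  rewrite sumEFin lee_fin big_const_seq count_predT iter_addr_0.
  apply: (@le_trans _ _ (e k *+ 2 ^ (k * k))%R).
    rewrite -[leLHS]mulr_natr -[leRHS]mulr_natr ler_wpM2l ?ler_nat//.
      exact: ltW.
    exact: (lP k dk).1.
  by rewrite /e -[leLHS]mulr_natr natrM invfM !mul1r mulrAC mulVf ?mul1r//.
move=> _ [f Ff [p Pp <-]] n _.
have [k /= nk Dk] := FD f Ff (maxn n d) I.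
have dk : (d <= k)%N by rewrite (leq_trans _ nk)// leq_maxr.
exists k; first by rewrite /= (leq_trans _ nk)// leq_maxl.
have [q ql pq] := (lP k dk).2 p Pp.
rewrite /U dk -bigcup_seq; exists q => //=.
(* The point of [D k] is [(f + p) + p], and [p] may be replaced by [q]. *)
apply: (hD k) Dk; rewrite -{1}[f](cantor_addK p).
exact: agree_add.
Qed.

End Null.

(** * Finite sums of a set with few restrictions *)

Lemma thin_leq (h h' : nat -> nat) P :
  (forall k, h k <= h' k) -> thin h' P -> thin h P.
Proof.
move=> hh [d dP]; exists d => k /dP[l lk lP]; exists l => // x /lP[y yl xy].
by exists y => //; exact: agree_leq xy.
Qed.

Lemma add_copies_sumset F B n :
  add_copies F B n = sumset F (add_copies [set (fun=> false)] B n).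
Proof.
elim: n => [|n /= ->].
  apply/seteqP; split=> [x Fx|_ [x Fx [_ /= -> <-]]].
    exists x => //; exists (fun=> false) => //.
    by apply/funext => i; rewrite /cantor_add addbF.
  rewrite (_ : cantor_add _ _ = x)//.
  by apply/funext => i; rewrite /cantor_add addbF.
apply/seteqP; split.
  move=> _ [_ [f Ff [s Ss <-]] [b Bb <-]]; rewrite cantor_addA.
  by exists f => //; exists (cantor_add s b) => //; exists s => //; exists b.
move=> _ [f Ff [_ [s Ss [b Bb <-]] <-]]; rewrite -cantor_addA.
by exists (cantor_add f s); [exists f => //; exists s|exists b].
Qed.

(** The [n]-fold sums have [(2 ^ k) ^ n] restrictions, which is within the bound
    of thinness once [n <= k]. *)
Lemma thin_add_copies h B n :
  (forall k, exists2 l : seq cantor_space, size l <= 2 ^ k &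
     forall x, B x -> exists2 y, y \in l & agree (h k) x y) ->
  thin h (add_copies [set (fun=> false)] B n).
Proof.
move=> few; exists n => k nk; have [l lk lP] := few k.
suff [l' l's l'P] : exists2 l' : seq cantor_space, size l' <= 2 ^ (k * n) &
    forall x, add_copies [set (fun=> false)] B n x ->
      exists2 y, y \in l' & agree (h k) x y.
  exists l' => //; apply: leq_trans l's _.
  by rewrite leq_exp2l// leq_mul2l nk orbT.
elim: n {nk} => [|n [l' l's l'P]].
  exists [:: (fun=> false) : cantor_space]; first by rewrite muln0.
  by move=> _ ->; exists (fun=> false); [exact: mem_head|exact: agree_refl].
exists [seq cantor_add x y | x <- l', y <- l].
  by rewrite size_allpairs mulnS addnC expnD leq_mul.
move=> _ [s /l'P[s' s'l ss] [b /lP[b' b'l bb] <-]].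
by exists (cantor_add s' b'); [exact: allpairs_f|exact: agree_add].
Qed.

(** * Thinning a tree *)

Lemma tree_prefix (T : set (seq bool)) s t :
  tree T -> prefix s t -> T t -> T s.
Proof. by move=> [_ pT] st Tt; exact: pT Tt st. Qed.

Section Thinning.
Variables (T : set (seq bool)) (h : nat -> nat).

(** [c] stands for the number of kept branchings strictly below [s]. *)
Definition selected (c : nat) (s : seq bool) : Prop :=
  splitting_nodes T s /\ h c <= size s.

(** Whether a node is selected depends on the number of nodes selected below it,
    so this number is computed by recursion along the initial segments. *)
Fixpoint selected_below (n : nat) (s : seq bool) : nat :=
  if n is m.+1 then
    selected_below m s + `[< selected (selected_below m s) (take m s) >]
  else 0.

Definition branchings (s : seq bool) : nat := selected_below (size s) s.

Definition keeps (s : seq bool) : Prop := selected (branchings s) s.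

Definition thinning : set (seq bool) :=
  [set s | T s /\ forall n, n < size s ->
    splitting_nodes T (take n s) -> ~ keeps (take n s) ->
    nth false s n = false].

Lemma selected_below_take n m s :
  n <= m -> selected_below n (take m s) = selected_below n s.
Proof.
elim: n => //= n IH nm; rewrite IH ?(ltnW nm)//.
by rewrite take_takel// ltnW.
Qed.

Lemma branchings_rcons s i :
  branchings (rcons s i) = branchings s + `[< keeps s >].
Proof.
rewrite /branchings size_rcons /= -(selected_below_take (rcons s i) (leqnn _)).
by rewrite -cats1 take_size_cat.
Qed.

Hypothesis treeT : tree T.

Lemma thinning_sub : thinning `<=` T. Proof. by move=> s []. Qed.

Lemma thinning_nil : thinning [::].
Proof.
have [[s Ts] _] := treeT; split => //.
by apply: tree_prefix Ts; [|exact: prefix0s].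
Qed.

Lemma thinning_rcons s i : thinning (rcons s i) <->
  [/\ thinning s, T (rcons s i) &
      splitting_nodes T s -> ~ keeps s -> i = false].
Proof.
have tk n : n <= size s -> take n (rcons s i) = take n s.
  by move=> ns; rewrite -cats1 takel_cat.
split=> [[Tsi H]|[[Ts H] Tsi Hi]].
  split => //.
    split => [|n ns].
      by apply: (tree_prefix treeT _ Tsi); exact: prefix_rcons.
    have := H n; rewrite size_rcons tk ?(ltnW ns)// nth_rcons ns; apply.
    exact: ltnW.
  have := H (size s); rewrite size_rcons tk// take_size nth_rcons ltnn eqxx.
  by apply.
split => // n; rewrite size_rcons ltnS leq_eqVlt => /predU1P[->|ns].
  by rewrite tk// take_size nth_rcons ltnn eqxx.
by rewrite tk ?(ltnW ns)// nth_rcons ns; exact: H.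
Qed.

Lemma tree_thinning : tree thinning.
Proof.
split; first by exists [::]; exact: thinning_nil.
move=> s t + /prefixP[u tE]; rewrite {}tE; elim/last_ind: u => [|u i IH].
  by rewrite cats0.
by rewrite -rcons_cat => /thinning_rcons[/IH].
Qed.

(** A kept node retains both successors, and a splitting node that is not kept
    loses the [true] one. *)
Lemma splitting_thinning s :
  splitting_nodes thinning s <-> thinning s /\ keeps s.
Proof.
split=> [[Ts /thinning_rcons[_ T0 _] /thinning_rcons[_ T1 H]]|[Ts [sp hs]]].
  split => //; apply: contrapT => nk.
  by have := H (And3 (thinning_sub Ts) T0 T1) nk.
have [_ T0 T1] := sp.
by split => //; apply/thinning_rcons; split => // _ [].
Qed.

Lemma leq_branchings_cat s u : branchings s <= branchings (s ++ u).
Proof.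
elim/last_ind: u => [|u i IH]; first by rewrite cats0.
by rewrite -rcons_cat branchings_rcons (leq_trans IH)// leq_addr.
Qed.

(** A node kept after [c] branchings has length at least [h c]; among the proper
    initial segments of a word of length at most [h k] this forces [c < k]. *)
Lemma branchings_le k s : {homo h : i j / i <= j} ->
  size s <= h k -> branchings s <= k.
Proof.
move=> hm; elim/last_ind: s => [//|s i IH]; rewrite size_rcons => sk.
rewrite branchings_rcons; case: asboolP => [[_ hs]|_]; last first.
  by rewrite addn0 IH// ltnW.
rewrite addn1 ltnNge; apply: contraTN sk => kb.
by rewrite -leqNgt (leq_trans (hm _ _ kb)).
Qed.

Hypothesis perfectT : perfect_tree T.

Lemma tree_extend s : T s -> exists i, T (rcons s i).
Proof.
move=> /perfectT.2[t [_ Tu _] /prefixP[u tE]]; rewrite {}tE in Tu.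
exists (head false (rcons u false)).
apply: (tree_prefix treeT _ Tu); rewrite rcons_cat -cats1 prefix_catr //.
by case: u {Tu} => [|b u] /=; rewrite !eqxx ?prefix0s.
Qed.

Lemma thinning_extend s : thinning s -> exists i, thinning (rcons s i).
Proof.
move=> Hs; have [sp|nsp] := pselect (splitting_nodes T s).
  by exists false; apply/thinning_rcons; split => //; case: sp.
have [i Ti] := tree_extend (thinning_sub Hs).
by exists i; apply/thinning_rcons; split.
Qed.

(** As long as the length is below the threshold [h c], nothing is kept and so
    the threshold does not move: following the thinned tree reaches it. *)
Lemma thinning_extend_long s : thinning s ->
  exists2 t, thinning t /\ h (branchings t) <= size t & prefix s t.
Proof.
have [n] := ubnP (h (branchings s) - size s); elim: n s => // n IH s.
rewrite ltnS => sn Hs; have [hs|hs] := leqP (h (branchings s)) (size s).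
  by exists s => //; exact: prefix_refl.
have [i Hi] := thinning_extend Hs.
have bE : branchings (rcons s i) = branchings s.
  rewrite branchings_rcons; case: asboolP => [[_]|_]; last by rewrite addn0.
  by rewrite leqNgt hs.
have [|t Ht st] := IH (rcons s i) _ Hi.
  rewrite bE size_rcons; apply: leq_trans sn.
  by rewrite subnS prednK// subn_gt0.
by exists t => //; apply: prefix_trans st; exact: prefix_rcons.
Qed.

(** Above the threshold the first splitting node of [T] is kept, and the path to
    it does not branch in [T], so it stays in the thinned tree. *)
Lemma perfect_thinning : perfect_tree thinning.
Proof.
split; first exact: tree_thinning.
move=> s /thinning_extend_long[t [Ht ht] st].
suff [r rs tr] : exists2 r, splitting_nodes thinning r & prefix t r.
  by exists r => //; exact: prefix_trans tr.
have [_ /[swap] /prefixP[u ->]] := perfectT.2 _ (thinning_sub Ht).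
elim: u t Ht ht {s st} => [|i u IH] t Ht ht.
  rewrite cats0 => sp; exists t; last exact: prefix_refl.
  by apply/splitting_thinning.
rewrite -cat_rcons => sp.
have [kt|nk] := pselect (keeps t).
  by exists t; [apply/splitting_thinning|exact: prefix_refl].
have Hti : thinning (rcons t i).
  apply/thinning_rcons; split=> //.
    by case: sp => + _ _; apply: (tree_prefix treeT); exact: prefix_prefix.
  by move=> spt; case: nk.
have [||r rs tr] := IH _ Hti.
- rewrite branchings_rcons size_rcons; case: asboolP => // _.
  by rewrite addn0 ltnW.
- by [].
by exists r => //; apply: prefix_trans tr; exact: prefix_rcons.
Qed.

(** The number of extensions at most doubles at a kept node, which uses up one
    of the [j] branchings; elsewhere the successor is unique. *)
Lemma few_extensions n j s : thinning s -> exists2 l : seq (seq bool),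
  size l <= 2 ^ j & forall u, thinning (s ++ u) -> size u = n ->
    branchings (s ++ u) <= branchings s + j -> s ++ u \in l.
Proof.
elim: n j s => [|n IH] j s Hs.
  exists [:: s]; first by rewrite expn_gt0.
  by move=> u _ /size0nil ->; rewrite cats0 mem_head.
have [ks|nks] := pselect (keeps s).
  have bE i : branchings (rcons s i) = (branchings s).+1.
    by rewrite branchings_rcons asboolT// addn1.
  case: j => [|j].
    exists [::] => //; case=> // i u _ _.
    have := leq_branchings_cat (rcons s i) u.
    rewrite bE cat_rcons addn0 => /leq_trans/[apply].
    by rewrite ltnn.
  have /splitting_thinning[_ H0 H1] : thinning s /\ keeps s by [].
  have [l0 l0s l0P] := IH j _ H0; have [l1 l1s l1P] := IH j _ H1.
  exists (l0 ++ l1); first by rewrite size_cat expnS mul2n -addnn leq_add.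
  move=> [//|i u] Hu [un]; rewrite addnS -addSn -(bE i) => bu.
  rewrite mem_cat; move: Hu bu; rewrite -cat_rcons.
  by case: i => Hu bu; [rewrite l1P ?orbT|rewrite l0P].
have [i Hi] := thinning_extend Hs.
have bE : branchings (rcons s i) = branchings s.
  by rewrite branchings_rcons asboolF// addn0.
have [l ls lP] := IH j _ Hi; exists l => // -[//|i' u] Hu [un] bu.
suff ii : i' = i.
  by move: Hu bu; rewrite ii -cat_rcons -bE => Hu bu; apply: lP.
have Hi' : thinning (rcons s i').
  apply: (tree_prefix tree_thinning _ Hu); rewrite -cat_rcons.
  exact: prefix_prefix.
apply: contrapT => ii; apply: nks.
suff /splitting_thinning[] : splitting_nodes thinning s by [].
by case: i i' Hi Hi' ii {bE lP Hu bu} => [] [].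
Qed.

Lemma thinning_level k : {homo h : i j / i <= j} ->
  exists2 l : seq (seq bool), size l <= 2 ^ k &
    forall s, thinning s -> size s = h k -> s \in l.
Proof.
move=> hm; have [l lk lP] := few_extensions (h k) k thinning_nil.
exists l => // s Hs sk; apply: (lP s Hs sk).
by rewrite branchings_le ?sk.
Qed.

(** Uniformly perfect trees and Silver trees share this property: at each level
    all nodes split or none does. Under it the choice of kept nodes depends on
    their length only. *)
Section Uniform.
Hypothesis uniformT : forall s t, T s -> T t -> size s = size t ->
  splitting_nodes T s -> splitting_nodes T t.

Lemma branchings_uniform s t : T s -> T t -> size s = size t ->
  branchings s = branchings t.
Proof.
rewrite /branchings => Ts Tt st; rewrite -st.
(* The induction is on a length [n] up to that of [s] and [t]. *)
have : size s <= size s by [].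
elim: {1 3 4}(size s) => //= n IH ns.
have Tk r m : T r -> T (take m r).
  apply: (tree_prefix treeT); rewrite -{2}(cat_take_drop m r).
  exact: prefix_prefix.
have sE : size (take n s) = size (take n t) by rewrite !size_take st.
rewrite IH ?(ltnW ns)//; congr (_ + nat_of_bool _); apply/asbool_equiv_eq.
rewrite /selected sE; split=> -[sp ?]; split => //; apply: uniformT sp; auto.
Qed.

Lemma keeps_uniform s t : T s -> T t -> size s = size t -> keeps s -> keeps t.
Proof.
move=> Ts Tt st [sp hs]; split; first exact: uniformT sp.
by rewrite -(branchings_uniform Ts Tt st) -st.
Qed.

End Uniform.
End Thinning.

Lemma thinning_body_few (T : set (seq bool)) h k :
  perfect_tree T -> {homo h : i j / i <= j} ->
  exists2 l : seq cantor_space, size l <= 2 ^ k &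
    forall x, body (thinning T h) x -> exists2 y, y \in l & agree (h k) x y.
Proof.
move=> pT hm; have [l lk lP] := thinning_level pT.1 pT k hm.
exists [seq (nth false s : cantor_space) | s <- l]; first by rewrite size_map.
move=> x Bx; exists (nth false (mkseq x (h k))).
  by apply: map_f; apply: lP; rewrite ?size_mkseq.
by move=> i ik; rewrite nth_mkseq.
Qed.

(** * The three classes of trees *)

Lemma uniformly_perfect_uniform (T : set (seq bool)) :
  uniformly_perfect_tree T ->
  forall s t, T s -> T t -> size s = size t ->
    splitting_nodes T s -> splitting_nodes T t.
Proof.
move=> [_ uT] s t Ts Tt st sp; have [|E] := uT (size s).
  by apply; split.
suff : set0 s by [].
by rewrite -E; split.
Qed.

Lemma silver_uniform (T : set (seq bool)) : silver_tree T ->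
  forall s t, T s -> T t -> size s = size t ->
    splitting_nodes T s -> splitting_nodes T t.
Proof. by move=> [_ sT] s t Ts Tt st [_ T0 T1]; split=> //; apply/(sT s t). Qed.

Lemma uniformly_perfect_thinning (T : set (seq bool)) h :
  uniformly_perfect_tree T -> uniformly_perfect_tree (thinning T h).
Proof.
move=> uT; have pT := uT.1; have unif := uniformly_perfect_uniform uT.
split=> [|n]; first exact: (perfect_thinning h pT.1 pT).
have [[s [sn /(splitting_thinning h pT.1)[Hs ks]]]|none] :=
    pselect (level n `&` splitting_nodes (thinning T h) !=set0); last first.
  by right; apply: contrapT => /eqP/set0P.
left=> t [tn Ht]; apply/(splitting_thinning h pT.1); split => //.
apply: (keeps_uniform pT.1 unif) ks; last by rewrite sn tn.
  exact: thinning_sub Hs.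
exact: thinning_sub Ht.
Qed.

Lemma silver_thinning (T : set (seq bool)) h :
  silver_tree T -> silver_tree (thinning T h).
Proof.
move=> sT; have pT := sT.1; have unif := silver_uniform sT.
split; first exact: (perfect_thinning h pT.1 pT).
move=> s t Hs Ht st i.
wlog suff : s t Hs Ht st / thinning T h (rcons s i) -> thinning T h (rcons t i).
  by move=> w; split; exact: w.
have [Ts Tt] := (thinning_sub Hs, thinning_sub Ht).
move=> /(thinning_rcons h pT.1)[_ Tsi Hi].
apply/(thinning_rcons h pT.1); split=> //; first exact/(sT.2 s t).
move=> spt nkt; apply: Hi; first by apply: unif spt.
by move=> ks; apply: nkt; apply: (keeps_uniform pT.1 unif) ks.
Qed.

(** * The theorem *)

(** The rate [h] is the sum up to [k] of those for category and for measure, so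
    that it exceeds both and is monotone, as the count of branchings below
    level [h k] requires. *)
Lemma small_sums (R : realType) (F : set cantor_space) :
  meager F -> null R F ->
  exists h, forall T, perfect_tree T -> forall n,
    meager (add_copies F (body (thinning T h)) n) /\
    null R (add_copies F (body (thinning T h)) n).
Proof.
move=> /meager_sumset[h1 h1P] /null_sumset[h2 h2P].
pose h k := \sum_(i < k.+1) (h1 i + h2 i).
have hm : {homo h : i j / i <= j}.
  move=> i j /subnKC <-; elim: (j - i) => [|m IH]; first by rewrite addn0.
  by rewrite addnS (leq_trans IH)// /h [leqRHS]big_ord_recr leq_addr.
have h12 k : h1 k + h2 k <= h k by rewrite /h big_ord_recr leq_addl.
exists h => T pT n.
have thinP : thin h (add_copies [set (fun=> false)] (body (thinning T h)) n).
  by apply: thin_add_copies => k; exact: thinning_body_few.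
rewrite add_copies_sumset; split.
  apply: h1P; apply: thin_leq thinP => k.
  exact: leq_trans (leq_addr _ _) (h12 k).
apply: h2P; apply: thin_leq thinP => k.
exact: leq_trans (leq_addl _ _) (h12 k).
Qed.

Theorem theorem17 (R : realType) (F : set cantor_space)
    (F_meager : meager F) (F_null : null R F) (T : set (seq bool)) :
  [/\ perfect_tree T ->
        exists T', [/\ perfect_tree T', T' `<=` T &
          forall n, meager (add_copies F (body T') n) /\
                    null R (add_copies F (body T') n)],
      uniformly_perfect_tree T ->
        exists T', [/\ uniformly_perfect_tree T', T' `<=` T &
          forall n, meager (add_copies F (body T') n) /\
                    null R (add_copies F (body T') n)] &
      silver_tree T ->
        exists T', [/\ silver_tree T', T' `<=` T &
          forall n, meager (add_copies F (body T') n) /\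
                    null R (add_copies F (body T') n)]].
Proof.
have [h hP] := small_sums F_meager F_null.
split=> hT; exists (thinning T h); split; try exact: thinning_sub.
- exact: (perfect_thinning h hT.1 hT).
- exact: hP.
- exact: uniformly_perfect_thinning.
- exact: hP hT.1.
- exact: silver_thinning.
- exact: hP hT.1.
Qed.
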